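(* Let $\Theta\sim G$ be a real random variable, $\Delta>0$ fixed, $\alpha\in(0,1)$ and $c=z_{1-\alpha/2}$. For $s>0$ let, conditionally on $\Theta$, $\hat\theta\sim N(\Theta,s^2)$, and let $S_s=\{|\hat\theta|>cs\}$, so that the conditional rejection probability given $\Theta=\theta$ is $q_s(\theta)=\Phi(-c-\theta/s)+\Phi(-c+\theta/s)$. Then, as $s\to\infty$, $q_s(\theta)\to\alpha$ for every fixed $\theta$, and $$P(|\Theta|<\Delta\mid S_s)\longrightarrow P(|\Theta|<\Delta).$$ If $G$ is continuous, then $P(|\Theta|<\Delta\mid S_s)\to P(|\Theta|<\Delta)$ also in the opposite limit $s\to0$.
   Context: $\Phi$ is the standard normal distribution function and $z_{1-\alpha/2}$ its $(1-\alpha/2)$-quantile. $S_s$ is the rejection event of the two-sided Gaussian point-null test of $H_0:\Theta=0$ at statistical-error scale $s$. ''$G$ continuous'' means that $G$ has no atoms. *)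

(* Defs.v *)
From HB Require Import structures.
From mathcomp Require Import all_boot all_order all_algebra.
From mathcomp Require Import all_classical all_reals all_analysis.
From mathcomp Require Import measurable_realfun.

Set Implicit Arguments.
Unset Strict Implicit.
Unset Printing Implicit Defensive.

Import Order.TTheory GRing.Theory Num.Theory.
Import numFieldNormedType.Exports.

Local Open Scope classical_set_scope.
Local Open Scope ring_scope.

Definition Phi {R : realType} (x : R) : R := fine (normal_prob 0 1 `]-oo, x]).

Definition normal_quantile {R : realType} (p : R) : R :=
  inf [set x | p <= Phi x].

Definition reject_prob {R : realType} (c s theta : R) : R :=
  Phi (- c - theta / s) + Phi (- c + theta / s).

(* [K] is a regular conditional distribution of [Y] given [X]. *)
Definition cond_distribution {d d1 d2 : measure_display} {R : realType}
    {T : measurableType d} {T1 : measurableType d1} {T2 : measurableType d2}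
    (P : probability T R) (X : {RV P >-> T1}) (Y : {RV P >-> T2})
    (K : T1 -> set T2 -> \bar R) : Prop :=
  (forall B, measurable B -> measurable_fun [set: T1] (K ^~ B)) /\
  (forall A B, measurable A -> measurable B ->
    P (X @^-1` A `&` Y @^-1` B) = \int[distribution P X]_(x in A) K x B)%E.

(* [q] is a version of the conditional probability x |-> P(E | X = x). *)
Definition cond_prob_given {d d1 : measure_display} {R : realType}
    {T : measurableType d} {T1 : measurableType d1}
    (P : probability T R) (E : set T) (X : {RV P >-> T1})
    (q : T1 -> R) : Prop :=
  measurable_fun [set: T1] q /\
  (forall A, measurable A ->
    P (X @^-1` A `&` E) = \int[distribution P X]_(x in A) (q x)%:E)%E.

(* Elementary conditional probability P(A | B); the value is 0 if P(B) = 0. *)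
Definition cond_prob {d : measure_display} {R : realType}
    {T : measurableType d} (P : probability T R) (A B : set T) : R :=
  fine (P (A `&` B)) / fine (P B).

Definition atomless {R : realType} (G : set R -> \bar R) : Prop :=
  forall x : R, G [set x] = 0%E.

(* Main.v *)
Require Import Defs.
From HB Require Import structures.
From mathcomp Require Import all_boot all_order all_algebra.
From mathcomp Require Import all_classical all_reals all_analysis.
From mathcomp Require Import measurable_realfun.
From mathcomp Require Import ring lra.

Import Order.TTheory GRing.Theory Num.Theory.
Import numFieldNormedType.Exports.

Local Open Scope classical_set_scope.
Local Open Scope ring_scope.

(* Two facts carry the proof: conditioning gives
   P(Theta \in A, S_s) = \int_A q_s dG, and 0 <= q_s <= 2.  If q_s tends G-almost
   everywhere to a nonzero constant l, dominated convergence makes numerator and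
   denominator of P(Theta \in A | S_s) tend to l G(A) and l.  Here l = alpha as
   s -> oo, and l = 1 as s -> 0, the exceptional point theta = 0 being G-null
   when G has no atoms. *)

(** * Normal tails, and regularity and quantiles of [Phi] *)

Section Phi_theory.
Context {R : realType}.
Implicit Types (m s a x y p : R).

Lemma PhiE x : (Phi x)%:E = normal_prob 0 1 `]-oo, x] :> \bar R.
Proof. by rewrite fineK// fin_num_measure. Qed.

(** The decreasing substitution [(m - x) / s] standardises and reflects at once, so an upper tail
    becomes a value of [Phi]. With [m = 0] and [s = 1] it yields the symmetry of [Phi]. *)
Lemma normal_prob_itvcy m s a : 0 < s ->
  normal_prob m s `[a, +oo[ = (Phi ((m - a) / s))%:E.
Proof.
move=> s0; rewrite PhiE /normal_prob.
pose F (x : R) : R := (m - x) / s.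
have dF x : is_derive x 1 F (- s^-1).
  rewrite /F; apply: is_derive_eq.
  by rewrite scaler0 !add0r mul1r scalerN -[_ *: _]/(_ * _) mulr1.
have F'E : F^`()%classic = cst (- s^-1).
  by apply/funext => x; rewrite derive1E derive_val.
rewrite -[(m - a) / s]/(F a) decreasing_ge0_integration_by_substitutiony//.
(* The Jacobian factor [s^-1] turns the peak of the standard density into that of N(m, s^2); the
   exponents agree because (m - x)^2 = (x - m)^2. *)
- apply: eq_integral => x _; rewrite F'E !fctE opprK; congr (_%:E).
  rewrite !normal_pdfE ?oner_neq0 ?gt_eqF// /normal_fun /normal_peak /F.
  rewrite expr1n mul1r subr0 -mulrnAr sqrtrM ?sqr_ge0// sqrtr_sqr gtr0_norm//.
  rewrite invfM [RHS]mulrC mulrA; congr (_ * expR _).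
  by rewrite -mulr_natr; field; rewrite gt_eqF.
- by move=> x y _ _ xy; rewrite /F ltr_pM2r ?invr_gt0// ltrD2l ltrN2.
- by rewrite F'E => ? _; exact: cvg_cst.
- by rewrite F'E; exact: is_cvg_cst.
- by rewrite F'E; exact: is_cvg_cst.
- split; first by move=> x _; exact: ex_derive.
  have : {for a, continuous F}.
    by apply: differentiable_continuous; apply/derivable1_diffP; exact: ex_derive.
  by move=> /cvg_at_right_filter.
- rewrite /F; apply/gt0_cvgMlNy; first by rewrite invr_gt0.
  apply: (cvg_comp -%R (fun r => m + r)); last exact: cvg_addrl_Ny.
  by apply/cvgNrNy; exact: cvg_id.
- apply: continuous_subspaceT; apply: continuous_normal_pdf; exact: oner_neq0.
- by move=> x _; exact: normal_pdf_ge0.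
Qed.

Lemma normal_prob_itvoy m s a :
  normal_prob m s `]a, +oo[ = normal_prob m s `[a, +oo[.
Proof.
apply: integral_itv_obnd_cbnd; apply/measurable_EFinP/measurable_funTS.
exact: measurable_normal_pdf.
Qed.

Lemma PhiN x : Phi (- x) = 1 - Phi x.
Proof.
apply/EFin_inj; rewrite EFinB [in RHS]PhiE -probability_setC//.
rewrite setCitvl; apply: esym; apply: etrans (normal_prob_itvoy _ _ _) _.
by rewrite normal_prob_itvcy// divr1 sub0r.
Qed.

Lemma Phi_ge0 x : 0 <= Phi x.
Proof. exact: fine_ge0. Qed.

Lemma Phi_le1 x : Phi x <= 1.
Proof. by rewrite -lee_fin PhiE probability_le1. Qed.

Lemma Phi_nondecreasing : {homo (@Phi R) : x y / x <= y}.
Proof.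
move=> x y xy; rewrite -lee_fin !PhiE le_measure ?inE//.
exact: subitvPr.
Qed.

Lemma measurable_Phi : measurable_fun setT (@Phi R).
Proof. by apply: nondecreasing_measurable => //; exact: Phi_nondecreasing. Qed.

Lemma Phi0 : Phi (0 : R) = 2^-1.
Proof. have := PhiN 0; rewrite oppr0; lra. Qed.

(** The increment is the mass of []x, y]], and the density never exceeds its peak. This is the
    source of the continuity of [Phi]. *)
Lemma Phi_lipschitz x y : x <= y -> Phi y - Phi x <= normal_peak 1 * (y - x).
Proof.
move=> xy.
have Nfin : normal_prob 0 1 `]x, y] \is a fin_num by exact: fin_num_measure.
have -> : Phi y = Phi x + fine (normal_prob 0 1 `]x, y]).
  apply/EFin_inj; rewrite EFinD (fineK Nfin) (PhiE y) (PhiE x).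
  have -> : `]-oo, y]%classic = `]-oo, x]%classic `|` `]x, y]%classic.
    by rewrite -itv_bndbnd_setU ?bnd_simp.
  rewrite measureU//; apply/seteqP; split=> z //=.
  by rewrite !in_itv/= => -[zx /andP[]]; rewrite ltNge zx.
rewrite addrAC subrr add0r -lee_fin (fineK Nfin).
apply: (@le_trans _ _
  (\int[lebesgue_measure]_(z in `]x, y]) (normal_peak 1)%:E)%E).
  apply: ge0_le_integral => //.
  - by move=> z _; rewrite lee_fin normal_pdf_ge0.
  - apply/measurable_EFinP/measurable_funTS; exact: measurable_normal_pdf.
  - by move=> z _; rewrite lee_fin normal_pdf_ub// oner_neq0.
rewrite integral_cst//= lebesgue_measure_itv/= lte_fin; case: ifPn => // _.
by rewrite mule0 lee_fin mulr_ge0 ?normal_peak_ge0// subr_ge0.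
Qed.

(* Phi is the cdf of the identity under N(0, 1). *)
Let idTR : measurableTypeR R -> R := idfun.

#[local] HB.instance Definition _ :=
  @isMeasurableFun.Build _ _ _ _ idTR (@measurable_id _ _ setT).

Lemma cvg_Phiy : Phi x @[x --> +oo] --> (1 : R).
Proof.
exact: (fine_cvg (cvg_cdfy1 (idTR : {RV @normal_prob R 0 1 >-> R}))).
Qed.

Lemma cvg_PhiNy : Phi x @[x --> -oo] --> (0 : R).
Proof.
exact: (fine_cvg (cvg_cdfNy0 (idTR : {RV @normal_prob R 0 1 >-> R}))).
Qed.

Lemma continuous_Phi : continuous (@Phi R).
Proof.
move=> x; apply/cvgrPdist_le => e e0.
have k0 : 0 < normal_peak (1 : R) by rewrite normal_peak_gt0// oner_neq0.
near=> y.
have : `|x - y| <= e / normal_peak 1.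
  by near: y; apply: cvgr_dist_le => //; rewrite divr_gt0.
rewrite ler_pdivlMr// => /(le_trans _); apply.
have [xy|/ltW xy] := leP x y.
  rewrite !ler0_norm ?subr_le0//; last exact: Phi_nondecreasing.
  by rewrite !opprB mulrC Phi_lipschitz.
rewrite !ger0_norm ?subr_ge0//; last exact: Phi_nondecreasing.
by rewrite mulrC Phi_lipschitz.
Unshelve. all: by end_near. Qed.

(** The limits 1 and 0 of [Phi] make [E] nonempty and bounded below, so [inf] is a true infimum;
    continuity at [c] then gives equality from the two one-sided limits. *)
Lemma Phi_normal_quantile p : 0 < p < 1 -> Phi (normal_quantile p) = p.
Proof.
move=> /andP[p0 p1]; set E := [set x | p <= Phi x]; set c := normal_quantile p.
have E0 : E !=set0.
  have [M [_ HM]] := cvgr_ge _ cvg_Phiy _ p1.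
  by exists (M + 1); apply: HM; rewrite ltrDl.
have lbE : has_lbound E.
  have [M [_ HM]] := cvgr_lt _ cvg_PhiNy _ p0.
  exists (M - 1) => x Ex; rewrite leNgt; apply/negP => xM.
  have : x < M by rewrite (lt_le_trans xM)// gerBl.
  by move=> /HM /=; rewrite ltNge Ex.
apply/eqP; rewrite eq_le; apply/andP; split.
  (* Points left of [c] lie outside [E], so [Phi] is below [p] there. *)
  apply: (@cvgr_to_le _ (c^'-) _ _ (@Phi R)).
    apply: cvg_at_left_filter; exact: continuous_Phi.
  near=> x; rewrite leNgt; apply/negP => px.
  have : c <= x by apply: ge_inf => //; exact: ltW.
  by rewrite leNgt => /negP; apply; near: x; exact: nbhs_left_lt.
(* Every [x] right of [c] exceeds some [y] in [E], so monotonicity gives [p <= Phi y <= Phi x]. *)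
apply: (@cvgr_to_ge _ (c^'+) _ _ (@Phi R)).
  apply: cvg_at_right_filter; exact: continuous_Phi.
near=> x; have cx : 0 < x - c by rewrite subr_gt0.
have [y Ey] := inf_adherent cx (conj E0 lbE).
rewrite [inf _ + _]subrKC => /ltW/Phi_nondecreasing; exact: le_trans.
Unshelve. all: by end_near. Qed.

End Phi_theory.

(** * The rejection probability and its pointwise limits in the scale *)

Section reject_prob_theory.
Context {R : realType}.
Implicit Types c s theta : R.

Lemma measurable_reject_prob c s : measurable_fun setT (reject_prob c s).
Proof.
apply: measurable_funD; apply: measurableT_comp (@measurable_Phi R) _.
  by apply: measurable_funB => //; exact: measurable_funM.
by apply: measurable_funD => //; exact: measurable_funM.
Qed.

Lemma reject_prob_bounded c s theta : `|reject_prob c s theta| <= 2.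
Proof.
rewrite ger0_norm ?addr_ge0 ?Phi_ge0//.
by rewrite -[2]/(1 + 1) lerD ?Phi_le1.
Qed.

(** The event is a union of two tails, disjoint because [c * s] is nonnegative. The lower tail is
    taken as the complement of a closed upper ray, so that one tail formula and [PhiN] serve
    both. *)
Lemma normal_prob_reject c s theta : 0 <= c -> 0 < s ->
  normal_prob theta s [set x | c * s < `|x|] = (reject_prob c s theta)%:E.
Proof.
move=> c0 s0; have cs0 : 0 <= c * s by rewrite mulr_ge0// ltW.
have -> : [set x : R | c * s < `|x|] =
    ~` `[- (c * s), +oo[ `|` `]c * s, +oo[.
  rewrite setCitvr; apply/seteqP; split=> x /=; rewrite !in_itv/= andbT.
    rewrite ltr_normr => /orP[|]; first by right.
    by rewrite ltrNr; left.
  by case=> cx; rewrite ltr_normr (ltrNr _ x) cx ?orbT.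
rewrite measureU//; last 2 first.
- exact: measurableC.
- rewrite setCitvr; apply/seteqP; split=> x //=.
  by rewrite !in_itv/= andbT => -[xc cx]; lra.
have lower : normal_prob theta s (~` `[- (c * s), +oo[) =
    (Phi (- c - theta / s))%:E.
  rewrite probability_setC// [X in (_ - X)%E]normal_prob_itvcy// -EFinB -PhiN.
  by congr (Phi _)%:E; field; rewrite gt_eqF.
have upper : normal_prob theta s `]c * s, +oo[ = (Phi (- c + theta / s))%:E.
  rewrite normal_prob_itvoy normal_prob_itvcy//.
  by congr (Phi _)%:E; field; rewrite gt_eqF.
exact: f_equal2 lower upper.
Qed.

(** The shift [theta / s] vanishes and [Phi] is continuous at [- c]. *)
Lemma cvg_reject_prob_infty c theta :
  reject_prob c s theta @[s --> +oo] --> Phi (- c) *+ 2.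
Proof.
have ts0 : theta / s @[s --> +oo] --> 0.
  rewrite -[0](mulr0 theta); apply: cvgMl_tmp.
  apply/(@gtr0_cvgV0 _ _ _ _ id); last exact: cvg_id.
  by exists 0.
have cc : - c @[s --> (+oo : set_system R)] --> - c by exact: cvg_cst.
have lo : - c - theta / s @[s --> +oo] --> - c - 0 by exact: cvgB.
have up : - c + theta / s @[s --> +oo] --> - c + 0 by exact: cvgD.
rewrite subr0 in lo; rewrite addr0 in up; rewrite mulr2n.
by apply: cvgD; apply: (continuous_cvg _ (continuous_Phi (- c))).
Qed.

(** For positive [theta] the shift [theta / s] blows up, sending the lower tail to 0 and the upper
    one to 1. At [theta = 0] there is no shift and the value stays at twice [Phi (- c)]. *)
Lemma cvg_reject_prob_0 c theta : theta != 0 ->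
  reject_prob c s theta @[s --> 0^'+] --> (1 : R).
Proof.
(* Changing the sign of [theta] only swaps the two summands. *)
wlog theta0 : theta / 0 < theta.
  move=> H t0; have [|tn] := ltP 0 theta; first by move=> /H; exact.
  have /H : 0 < - theta by rewrite oppr_gt0 lt_neqAle t0.
  rewrite oppr_eq0 t0 => /(_ isT).
  by under eq_fun do rewrite /reject_prob mulNr opprK addrC.
move=> _.
have tsy : theta / s @[s --> 0^'+] --> +oo.
  under eq_fun do rewrite mulrC; apply: gt0_cvgMly => //.
  apply/(@cvgrVy _ _ _ _ id); first exact: nbhs_right_gt.
  by apply: cvg_at_right_filter; exact: cvg_id.
rewrite -[1]add0r; apply: cvgD.
  apply: (cvg_comp (fun s => - c - theta / s) (@Phi R)); last exact: cvg_PhiNy.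
  apply: (cvg_comp (fun s => - (theta / s)) (fun r => - c + r)).
    exact/cvgNrNy.
  exact: cvg_addrl_Ny.
apply: (cvg_comp (fun s => - c + theta / s) (@Phi R)); last exact: cvg_Phiy.
by apply: (cvg_comp _ (fun r => - c + r) tsy); exact: cvg_addrl.
Qed.

End reject_prob_theory.

(** Sequences are used because dominated convergence is stated for them. The conditional probability
    formula is asked only eventually, since a sequence of scales tending to infinity need only be
    positive from some index on. *)
Lemma cvg_cond_prob_given {d d1 : measure_display} {R : realType}
    {T : measurableType d} {T1 : measurableType d1} (P : probability T R)
    (X : {RV P >-> T1}) (E : (set T)^nat) (q : (T1 -> R)^nat) (l M : R)
    (A : set T1) :
  l != 0 ->
  (forall n, measurable_fun setT (q n)) ->
  (forall n x, `|q n x| <= M) ->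
  {ae distribution P X, forall x, q n x @[n --> \oo] --> l} ->
  (\forall n \near \oo, cond_prob_given (E n) X (q n)) ->
  measurable A ->
  cond_prob P (X @^-1` A) (E n) @[n --> \oo] --> fine (P (X @^-1` A)).
Proof.
move=> l0 mq qM ql Eq mA.
(* A general [B] covers the numerator, with [B = A], and the denominator, with [B = setT]. *)
have cvgPE B : measurable B ->
    fine (P (X @^-1` B `&` E n)) @[n --> \oo] --> l * fine (P (X @^-1` B)).
  move=> mB.
  have mqE n : measurable_fun B (fun x => (q n x)%:E).
    by apply/measurable_EFinP; exact: measurable_funTS.
  have [||||_ _] := @dominated_convergence _ _ _ (distribution P X) B mB
    (fun n x => (q n x)%:E) (cst l%:E) (cst M%:E) mqE.
  - exact: measurable_cst.
  - apply: filterS ql => x qx _; apply: cvg_EFin => //.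
    by near=> n.
  - by apply: finite_measure_integrable_cst.
  - by apply: aeW => x n _; rewrite lee_fin.
  rewrite integral_cst//= => cvgI; apply: fine_cvg.
  rewrite EFinM fineK; last by apply: fin_num_measure; exact: measurable_funPTI.
  apply: cvg_trans cvgI; apply: near_eq_cvg.
  by apply: filterS Eq => n [_ EqA]; exact: esym (EqA _ mB).
rewrite /cond_prob.
(* The target is written as the quotient of the two limits; [l != 0] permits the cancellation. *)
have -> : fine (P (X @^-1` A)) = (l * fine (P (X @^-1` A))) / l.
  by rewrite mulrAC divff// mul1r.
apply: cvgM; first exact: cvgPE.
apply: cvgV => //.
have := cvgPE setT measurableT.
rewrite preimage_setT probability_setT mulr1.
by under eq_fun do rewrite setTI.
Unshelve. all: by end_near. Qed.

Theorem mainTheorem11 (R : realType) (d : measure_display)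
    (Omega : measurableType d) (P : probability Omega R)
    (Theta : {RV P >-> R}) (thetahat : R -> {RV P >-> R})
    (Delta alpha c : R) (S : R -> set Omega)
    (hDelta : 0 < Delta) (halpha : 0 < alpha < 1)
    (hc : c = normal_quantile (1 - alpha / 2))
    (hthetahat : forall s : R, 0 < s ->
      cond_distribution Theta (thetahat s) (fun theta => normal_prob theta s))
    (hS : forall s : R, S s = [set w | c * s < `|thetahat s w|]) :
  (forall s : R, 0 < s ->
    (forall theta : R,
      normal_prob theta s [set x | c * s < `|x|] =
        (reject_prob c s theta)%:E) /\
    cond_prob_given (S s) Theta (reject_prob c s)) /\
  (forall theta : R, reject_prob c s theta @[s --> +oo] --> alpha) /\
  (cond_prob P [set w | `|Theta w| < Delta] (S s) @[s --> +oo] -->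
    fine (P [set w | `|Theta w| < Delta])) /\
  (atomless (distribution P Theta) ->
    cond_prob P [set w | `|Theta w| < Delta] (S s) @[s --> 0^'+] -->
      fine (P [set w | `|Theta w| < Delta])).
Proof.
have Phic : Phi c = 1 - alpha / 2 by rewrite hc Phi_normal_quantile//; lra.
(* As [alpha < 1], [Phi c] exceeds 1/2, the value of [Phi] at 0. The sign of [c] is what makes the
   two rejection tails disjoint. *)
have c0 : 0 <= c.
  rewrite leNgt; apply/negP => /ltW/Phi_nondecreasing.
  rewrite Phic Phi0; lra.
have Sq s : 0 < s -> cond_prob_given (S s) Theta (reject_prob c s).
  move=> s0; split; first exact: measurable_reject_prob.
  move=> A mA; have [_ /(_ A [set x | c * s < `|x|] mA)] := hthetahat _ s0.
  rewrite hS => ->.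
    by apply: eq_integral => theta _; rewrite normal_prob_reject.
  have -> : [set x : R | c * s < `|x|] = Num.norm @^-1` `]c * s, +oo[.
    by apply/seteqP; split=> x /=; rewrite in_itv/= andbT.
  exact: measurable_funPTI.
have qa theta : reject_prob c s theta @[s --> +oo] --> alpha.
  have -> : alpha = Phi (- c) *+ 2 by rewrite PhiN Phic; lra.
  exact: cvg_reject_prob_infty.
have mD : measurable [set x : R | `|x| < Delta].
  have -> : [set x : R | `|x| < Delta] = Num.norm @^-1` `]-oo, Delta[.
    by apply/seteqP; split=> x /=; rewrite in_itv.
  exact: measurable_funPTI.
split.
  move=> s s0; split=> [theta|]; [exact: normal_prob_reject|exact: Sq].
split=> //; split.
  (* Along any sequence of scales tending to infinity, the limit [alpha] holds at every [theta], and
     2 dominates. *)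
  apply/cvg_pinftyP => u uy.
  apply: (@cvg_cond_prob_given _ _ _ _ _ P Theta (S \o u)
    (fun n => reject_prob c (u n)) alpha 2 _ _ _ _ _ _ mD).
  - by rewrite gt_eqF//; case/andP: halpha.
  - by move=> n; exact: measurable_reject_prob.
  - by move=> n x; exact: reject_prob_bounded.
  - by apply: aeW => x; exact: (cvg_comp u (reject_prob c ^~ x) uy (qa x)).
  - near=> n; apply: Sq; near: n; exact: (cvgryPgt u).1.
move=> G0; apply/cvg_at_rightP => u [u0 ucvg].
apply: (@cvg_cond_prob_given _ _ _ _ _ P Theta (S \o u)
  (fun n => reject_prob c (u n)) 1 2 _ _ _ _ _ _ mD).
- exact: oner_neq0.
- by move=> n; exact: measurable_reject_prob.
- by move=> n x; exact: reject_prob_bounded.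
(* Pointwise convergence to 1 can fail only at [theta = 0], a null set by atomlessness. *)
- exists [set 0]; split; [exact: measurable_set1|exact: G0|].
  move=> x /=; apply: contra_notP => /eqP x0.
  by have /cvg_at_rightP := cvg_reject_prob_0 c _ x0; apply.
- by near=> n; exact: Sq.
Unshelve. all: by end_near. Qed.
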